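(* Let $\boldsymbol\xi_1,\dots,\boldsymbol\xi_N\in\mathbb R^d$, let $n_1,\dots,n_K$ be positive integers with $n_1+\dots+n_K=N$, and let $d_{ij}=\|\boldsymbol\xi_i-\boldsymbol\xi_j\|^2$. The cardinality-constrained $K$-means clustering problem $$\min\Big\{\sum_{k=1}^K\sum_{i\in I_k}\Big\|\boldsymbol\xi_i-\tfrac1{n_k}\Big(\sum_{j\in I_k}\boldsymbol\xi_j\Big)\Big\|^2:\ (I_1,\dots,I_K)\in\mathfrak P(n_1,\dots,n_K)\Big\}$$ is equivalent to the mixed-integer linear program $$\begin{aligned}\text{minimize}\quad&\tfrac12\sum_{k=1}^K\tfrac1{n_k}\sum_{i,j=1}^N d_{ij}\,\eta_{ij}^k\\ \text{subject to}\quad&\pi_i^k\in\{0,1\},\ \eta_{ij}^k\in\mathbb R_+ && i,j=1,\dots,N,\ k=1,\dots,K\\ &\textstyle\sum_{i=1}^N\pi_i^k=n_k && k=1,\dots,K\\ &\textstyle\sum_{k=1}^K\pi_i^k=1 && i=1,\dots,N\\ &\eta_{ij}^k\ge\pi_i^k+\pi_j^k-1 && i,j=1,\dots,N,\ k=1,\dots,K.\end{aligned}$$ That is, the two problems have the same optimal value, and a partition $(I_1,\dots,I_K)\in\mathfrak P(n_1,\dots,n_K)$ is optimal in the clustering problem if and only if the binary variables defined by $\pi_i^k=1$ if $i\in I_k$ and $\pi_i^k=0$ otherwise are the $\pi$-part of some optimal solution of the mixed-integer linear program.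
   Context: $\|\cdot\|$ is the Euclidean norm. $\mathfrak P(n_1,\dots,n_K)$ is the set of ordered partitions $(I_1,\dots,I_K)$ of $\{1,\dots,N\}$ into $K$ pairwise disjoint sets with $|I_k|=n_k$ for all $k$ and $\bigcup_k I_k=\{1,\dots,N\}$. *)

(* Defs.v *)
From mathcomp Require Import all_boot all_order all_algebra.
From mathcomp Require Import reals.

Set Implicit Arguments.
Unset Strict Implicit.
Unset Printing Implicit Defensive.

Import Order.TTheory GRing.Theory Num.Theory.
Local Open Scope ring_scope.

(* The norm [`|x|] that MathComp-Analysis puts on row vectors is the max norm,
   so the Euclidean norm is defined here. *)
Definition enorm (R : realType) (d : nat) (x : 'rV[R]_d) : R :=
  Num.sqrt (\sum_(i < d) x 0 i ^+ 2).

Definition is_minimizer (R : realType) (T : Type) (F : T -> Prop) (f : T -> R)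
    (x : T) : Prop :=
  F x /\ forall y, F y -> f x <= f y.

Definition is_min_value (R : realType) (T : Type) (F : T -> Prop) (f : T -> R)
    (v : R) : Prop :=
  exists2 x, is_minimizer F f x & f x = v.

Definition ordered_partition (N K : nat) (n : 'I_K -> nat)
    (I : {ffun 'I_K -> {set 'I_N}}) : Prop :=
  [/\ forall k l, k != l -> [disjoint I k & I l],
      forall k, #|I k| = n k
    & \bigcup_(k < K) I k = [set: 'I_N]].

Definition kmeans_cost (R : realType) (d N K : nat) (n : 'I_K -> nat)
    (xi : 'I_N -> 'rV[R]_d) (I : {ffun 'I_K -> {set 'I_N}}) : R :=
  \sum_(k < K) \sum_(i in I k)
    enorm (xi i - (n k)%:R^-1 *: \sum_(j in I k) xi j) ^+ 2.

Definition sqdist (R : realType) (d N : nat) (xi : 'I_N -> 'rV[R]_d)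
    (i j : 'I_N) : R :=
  enorm (xi i - xi j) ^+ 2.

(* A decision is a pair [(pi, eta)], with [pi i k] and [eta i j k] standing for
   pi_i^k and eta_ij^k. *)
Definition milp_var (R : realType) (N K : nat) : Type :=
  (('I_N -> 'I_K -> R) * ('I_N -> 'I_N -> 'I_K -> R))%type.

Definition milp_feasible (R : realType) (N K : nat) (n : 'I_K -> nat)
    (z : milp_var R N K) : Prop :=
  let: (pi, eta) := z in
  [/\ forall i k, pi i k = 0 \/ pi i k = 1,
      forall i j k, 0 <= eta i j k,
      forall k, \sum_(i < N) pi i k = (n k)%:R,
      forall i, \sum_(k < K) pi i k = 1
    & forall i j k, pi i k + pi j k - 1 <= eta i j k].

Definition milp_cost (R : realType) (d N K : nat) (n : 'I_K -> nat)
    (xi : 'I_N -> 'rV[R]_d) (z : milp_var R N K) : R :=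
  2^-1 * \sum_(k < K) (n k)%:R^-1 *
    (\sum_(i < N) \sum_(j < N) sqdist xi i j * z.2 i j k).

Definition assignment (R : realType) (N K : nat)
    (I : {ffun 'I_K -> {set 'I_N}}) (i : 'I_N) (k : 'I_K) : R :=
  if i \in I k then 1 else 0.

(* Main.v *)
Require Import Defs.
From mathcomp Require Import all_boot all_order all_algebra.
From mathcomp Require Import reals boolp.
From mathcomp Require Import ring.

(* For a block of size m, the sum of squared distances to the centroid is
   (2 m)^-1 times the sum of all pairwise squared distances.  For a fixed
   assignment pi, every feasible eta_ij^k dominates pi_i^k * pi_j^k, and this
   product is itself feasible, so minimising over eta returns exactly the
   clustering cost of the partition encoded by pi. *)

Set Implicit Arguments.
Unset Strict Implicit.
Unset Printing Implicit Defensive.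

Import Order.TTheory GRing.Theory Num.Theory.
Local Open Scope ring_scope.

(** With m the size, S the sum and Q the sum of squares, both sides equal Q - S^2 / m. *)
Lemma sum_sqr_sub_mean (F : numFieldType) (T : finType) (A : {set T})
    (a : T -> F) : (0 < #|A|)%N ->
  \sum_(i in A) (a i - #|A|%:R^-1 * \sum_(j in A) a j) ^+ 2 =
  2^-1 * (#|A|%:R^-1 * \sum_(i in A) \sum_(j in A) (a i - a j) ^+ 2).
Proof.
move=> A_gt0; have m0 : #|A|%:R != 0 :> F by rewrite pnatr_eq0 -lt0n.
set m : F := #|A|%:R in m0 *; set S := \sum_(j in A) a j.
set Q := \sum_(j in A) a j ^+ 2.
have sumC c : \sum_(i in A) c = m * c :> F by rewrite sumr_const mulr_natl.
(* Needed at two centres: c = a i for the inner pairwise sum, and c = S / m for the left-hand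
   side. *)
have sumE c : \sum_(i in A) (a i - c) ^+ 2 = Q - 2 * c * S + m * c ^+ 2.
  rewrite -sumC /Q /S mulr_sumr -sumrB -big_split /=.
  by apply: eq_bigr => i _; ring.
have -> : \sum_(i in A) \sum_(j in A) (a i - a j) ^+ 2 =
    m * Q - 2 * S * S + m * Q.
  transitivity (\sum_(i in A) (Q - 2 * a i * S + m * a i ^+ 2)).
    apply: eq_bigr => i _; rewrite -sumE.
    by apply: eq_bigr => j _; rewrite -sqrrN opprB.
  rewrite big_split sumrB sumC /= -mulr_sumr -/Q.
  by rewrite -mulr_suml -mulr_sumr.
by rewrite sumE; field.
Qed.

Lemma enorm_sqr (R : realType) (d : nat) (x : 'rV[R]_d) :
  enorm x ^+ 2 = \sum_(c < d) x 0 c ^+ 2.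
Proof. by rewrite sqr_sqrtr // sumr_ge0 // => c _; rewrite sqr_ge0. Qed.

(** Squared Euclidean norms split over coordinates; moving the coordinate sum outermost leaves the
    scalar identity in each coordinate. *)
Lemma sum_sqr_enorm_sub_centroid (R : realType) (d N : nat)
    (xi : 'I_N -> 'rV[R]_d) (A : {set 'I_N}) : (0 < #|A|)%N ->
  \sum_(i in A) enorm (xi i - #|A|%:R^-1 *: \sum_(j in A) xi j) ^+ 2 =
  2^-1 * (#|A|%:R^-1 * \sum_(i in A) \sum_(j in A) sqdist xi i j).
Proof.
move=> A_gt0.
under eq_bigr do rewrite enorm_sqr.
rewrite exchange_big /=.
under [in RHS]eq_bigr => i _.
  under eq_bigr do rewrite /sqdist enorm_sqr.
  rewrite exchange_big /=.
  over.
rewrite [in RHS]exchange_big /= !mulr_sumr.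
apply: eq_bigr => c _.
under eq_bigr do rewrite !mxE summxE.
rewrite (sum_sqr_sub_mean (fun i => xi i 0 c)) //; congr (_ * (_ * _)).
by apply: eq_bigr => i _; apply: eq_bigr => j _; rewrite !mxE.
Qed.

(** On 0/1 values the product is max(0, pi_i + pi_j - 1), the least value that the constraints on
    eta allow. *)
Definition product_eta (R : realType) (N K : nat)
    (I : {ffun 'I_K -> {set 'I_N}}) (i j : 'I_N) (k : 'I_K) : R :=
  assignment R I i k * assignment R I j k.

Section Equivalence.

Variables (R : realType) (d N K : nat) (xi : 'I_N -> 'rV[R]_d).
Variable n : 'I_K -> nat.
Hypothesis n_gt0 : forall k, (0 < n k)%N.

Implicit Type I : {ffun 'I_K -> {set 'I_N}}.

Lemma milp_cost_product_eta I : ordered_partition n I ->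
  milp_cost n xi (assignment R I, product_eta R I) = kmeans_cost n xi I.
Proof.
case=> _ cardI _; rewrite /milp_cost /kmeans_cost mulr_sumr.
apply: eq_bigr => k _; rewrite -cardI sum_sqr_enorm_sub_centroid ?cardI //.
congr (_ * (_ * _)); rewrite [RHS]big_mkcond /=; apply: eq_bigr => i _.
rewrite /product_eta /assignment; case: ifP => _; last first.
  by rewrite big1 // => j _; rewrite mul0r mulr0.
rewrite [RHS]big_mkcond /=; apply: eq_bigr => j _.
by rewrite mul1r; case: ifP; rewrite ?mulr1 ?mulr0.
Qed.

Lemma sum_assignment_block I k :
  \sum_(i < N) assignment R I i k = #|I k|%:R.
Proof. by rewrite -big_mkcond sumr_const. Qed.

Lemma product_eta_feasible I : ordered_partition n I ->
  milp_feasible n (assignment R I, product_eta R I).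
Proof.
case=> disjI cardI coverI; split; rewrite /product_eta.
- by move=> i k; rewrite /assignment; case: ifP; [right | left].
- by move=> i j k; rewrite /assignment mulr_ge0 //; case: ifP; rewrite ?ler01.
- by move=> k; rewrite sum_assignment_block cardI.
- move=> i; have : i \in \bigcup_(k < K) I k by rewrite coverI inE.
  case/bigcupP=> k _ ik; rewrite (bigD1 k) //= {1}/assignment ik.
  rewrite big1 ?addr0 // => l lk; rewrite /assignment.
  by rewrite (disjointFl (disjI _ _ lk) ik).
- move=> i j k; rewrite /assignment; do 2 case: ifP => _.
  + by rewrite mulr1 addrK.
  + by rewrite mulr0 addr0 subrr.
  + by rewrite mul0r add0r subrr.
  + by rewrite mul0r add0r sub0r oppr_le0 ler01.
Qed.

(** The weights 1 / n_k and d_ij are nonnegative, so the cost is monotone in eta and a termwise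
    comparison with [product_eta] suffices. *)
Lemma kmeans_cost_le_milp I z : ordered_partition n I ->
  milp_feasible n z -> z.1 = assignment R I ->
  kmeans_cost n xi I <= milp_cost n xi z.
Proof.
case: z => p eta pI [_ eta_ge0 _ _ eta_ge] /= p_def.
rewrite -milp_cost_product_eta // /milp_cost ler_wpM2l ?invr_ge0 ?ler0n //.
apply: ler_sum => k _; rewrite ler_wpM2l ?invr_ge0 ?ler0n //.
apply: ler_sum => i _; apply: ler_sum => j _.
rewrite ler_wpM2l ?sqr_ge0 //=.
have := eta_ge i j k; rewrite p_def /product_eta /assignment.
(* If i and j both lie in block k, the linear constraint forces eta to be at least 1; otherwise the
   product is 0 and nonnegativity of eta is enough. *)
by do 2 case: ifP => _; rewrite ?mulr0 ?mul0r // mulr1 addrK.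
Qed.

(** Block k collects the points where pi is 1. The sums over k give disjointness and covering; the
    sums over i give the block sizes. *)
Lemma milp_feasible_partition (z : milp_var R N K) : milp_feasible n z ->
  exists2 I, ordered_partition n I & z.1 = assignment R I.
Proof.
case: z => p eta [p01 _ sum_block sum_point _].
pose I := [ffun k => [set i | p i k == 1]] : {ffun 'I_K -> {set 'I_N}}.
have pE i k : p i k = assignment R I i k.
  rewrite /assignment ffunE inE; case: (p01 i k) => -> //; last by rewrite eqxx.
  by rewrite eq_sym oner_eq0.
have p_ge0 i k : 0 <= p i k by case: (p01 i k) => ->; rewrite ?ler01.
exists I; last by apply/funext => i; apply/funext => k; apply: pE.
split.
- move=> k l kl; apply/pred0P => i /=; apply/negbTE/negP => /andP[].
  rewrite !ffunE !inE => /eqP pk /eqP pl.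
  (* A point in two blocks would have total 1 + 1 plus a nonnegative rest, which exceeds 1. *)
  have := sum_point i; rewrite (bigD1 k) //= (bigD1 l) 1?eq_sym //= pk pl.
  move=> /eqP; rewrite -subr_eq0 addrAC subrr add0r gt_eqF //.
  by rewrite ltr_pwDl // sumr_ge0.
- move=> k; apply/eqP; rewrite -(eqr_nat R) -sum_block -sum_assignment_block.
  by apply/eqP/eq_bigr => i _; rewrite pE.
- apply/setP => i; rewrite inE; apply/bigcupP.
  have [k pk|p0] := pickP (fun k => p i k == 1).
    by exists k; rewrite // ffunE inE.
  have := sum_point i; rewrite big1 => [/eqP|k _]; first by rewrite eq_sym oner_eq0.
  by case: (p01 i k) => // pk; have := p0 k; rewrite pk eqxx.
Qed.

End Equivalence.

(** [tagnat] identifies the ordinals below the sum of the n k with pairs of a block k and a position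
    below n k; grouping by first component gives the partition. *)
Lemma ordered_partition_exists (K : nat) (n : 'I_K -> nat) :
  exists I : {ffun 'I_K -> {set 'I_(\sum_(k < K) n k)}}, ordered_partition n I.
Proof.
exists [ffun k => [set i | tagnat.sig1 i == k]]; split.
- move=> k l kl; apply/pred0P => i /=; rewrite !ffunE !inE.
  by apply/negbTE/negP => /andP[/eqP-> /eqP kl']; rewrite kl' eqxx in kl.
(* Block k is the image of ['I_(n k)] under [tagnat.Rank k], which is injective because it is
   increasing. *)
- move=> k; rewrite ffunE -[RHS]card_ord -(card_imset _ (inc_inj (@tagnat.le_Rank _ n k))).
  apply: eq_card => i; rewrite inE; apply/eqP/imsetP => [<-|[j _ ->]].
    by exists (tagnat.sig2 i); rewrite // tagnat.sig2K.
  by rewrite tagnat.Rank1K.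
- apply/setP => i; rewrite inE; apply/bigcupP.
  by exists (tagnat.sig1 i); rewrite // ffunE inE.
Qed.

(** There are finitely many candidates; classical logic makes F boolean so that [arg_minP]
    applies. *)
Lemma is_minimizer_exists (R : realType) (T : finType) (F : T -> Prop)
    (f : T -> R) : (exists x, F x) -> exists x, is_minimizer F f x.
Proof.
case=> x0 /asboolP Fx0.
case: (@arg_minP _ _ _ x0 (fun x => `[< F x >]) f Fx0) => x /asboolP Fx x_min.
by exists x; split=> // y /asboolP; apply: x_min.
Qed.

Theorem proposition2 (R : realType) (d N K : nat)
    (xi : 'I_N -> 'rV[R]_d) (n : 'I_K -> nat)
    (n_gt0 : forall k : 'I_K, (0 < n k)%N)
    (sum_n : (\sum_(k < K) n k)%N = N) :
  (exists v : R,
      is_min_value (@ordered_partition N K n) (kmeans_cost n xi) v /\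
      is_min_value (@milp_feasible R N K n) (milp_cost n xi) v)
  /\
  (forall I : {ffun 'I_K -> {set 'I_N}},
      ordered_partition n I ->
      (is_minimizer (@ordered_partition N K n) (kmeans_cost n xi) I <->
       exists eta : 'I_N -> 'I_N -> 'I_K -> R,
         is_minimizer (@milp_feasible R N K n) (milp_cost n xi)
           (assignment R I, eta))).
Proof.
have minimizer_milp I : is_minimizer (@ordered_partition N K n) (kmeans_cost n xi) I ->
    is_minimizer (@milp_feasible R N K n) (milp_cost n xi)
      (assignment R I, product_eta R I).
  case=> pI I_min; split=> [|z Fz]; first exact: product_eta_feasible.
  rewrite milp_cost_product_eta //.
  (* The cost of z is bounded below by the clustering cost of the partition J that it encodes, hence
     by that of I. *)
  have [J pJ zJ] := milp_feasible_partition Fz.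
  exact: le_trans (I_min _ pJ) (kmeans_cost_le_milp xi n_gt0 pJ Fz zJ).
split.
  have : exists I : {ffun 'I_K -> {set 'I_N}}, ordered_partition n I.
    by rewrite -sum_n; apply: ordered_partition_exists.
  case/(is_minimizer_exists (kmeans_cost n xi)) => I I_min.
  exists (kmeans_cost n xi I); split; first by exists I.
  exists (assignment R I, product_eta R I); first exact: minimizer_milp.
  by apply: milp_cost_product_eta => //; case: I_min.
move=> I pI; split=> [I_min|[eta [Fz z_min]]].
  by exists (product_eta R I); apply: minimizer_milp.
(* The clustering cost of I is at most the program's cost at the optimal eta, which is at most its
   cost at the feasible point built from J. *)
split=> // J pJ; rewrite -(milp_cost_product_eta xi n_gt0 pJ).
exact: le_trans (kmeans_cost_le_milp xi n_gt0 pI Fz erefl)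
  (z_min _ (product_eta_feasible R pJ)).
Qed.
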